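(* For every dimension $d\ge 1$, every positive integer $k$, and every real $\varepsilon>0$, there exists a positive integer $N=N(d,k,\varepsilon)$ such that any point set $S$ in $\mathbb{R}^d$ with at least $N$ points has a subset of $k$ points that is $\varepsilon$-collinear.
   Context: A finite point set $K\subset\mathbb{R}^d$ is $\varepsilon$-collinear if in every triangle determined by $K$ (i.e. with vertices at three distinct points of $K$), two of its interior angles are at most $\varepsilon$ (angles in radians; a degenerate triangle on three collinear points has angles $0,0,\pi$). *)

(* Defs.v *)
From mathcomp Require Import all_boot all_order all_algebra.
From mathcomp Require Import finmap.
From mathcomp Require Import all_classical all_reals all_analysis.

Set Implicit Arguments.
Unset Strict Implicit.
Unset Printing Implicit Defensive.

Import Order.TTheory GRing.Theory Num.Theory.

Local Open Scope ring_scope.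

(* Points of R^d are row vectors.  The norm that the library puts on 'rV[R]_d
   is the sup norm, so the Euclidean structure is introduced here. *)
Definition dotp (R : realType) (d : nat) (u v : 'rV[R]_d) : R :=
  \sum_(i < d) u ord0 i * v ord0 i.

Definition enorm (R : realType) (d : nat) (u : 'rV[R]_d) : R :=
  Num.sqrt (dotp u u).

(* The interior angle at b of the triangle a b c, in radians; meaningful when
   a != b and c != b. *)
Definition angle (R : realType) (d : nat) (a b c : 'rV[R]_d) : R :=
  acos (dotp (a - b) (c - b) / (enorm (a - b) * enorm (c - b))).

(* The vertices are only required to be distinct: collinear triples count as
   triangles, with angles 0, 0 and pi. *)
Definition eps_collinear (R : realType) (d : nat) (eps : R)
    (K : {fset 'rV[R]_d}) : Prop :=
  forall a b c : 'rV[R]_d, a \in K -> b \in K -> c \in K ->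
    a != b -> b != c -> c != a ->
    let alpha := angle c a b in
    let beta := angle a b c in
    let gamma := angle b c a in
    [\/ alpha <= eps /\ beta <= eps,
        beta <= eps /\ gamma <= eps
      | gamma <= eps /\ alpha <= eps].

(* Main.v *)
Require Import Defs.
From mathcomp Require Import all_boot all_order all_algebra.
From mathcomp Require Import finmap.
From mathcomp Require Import all_classical all_reals all_analysis.
From mathcomp Require Import zify ring lra.

(** Enumerate S as a sequence and colour a pair x, y (x before y) by the cell, in
    a fine finite subdivision of the sphere, that contains the direction of
    y - x.  By Ramsey's theorem a long sequence contains a subsequence of k
    points in which all pairs have the same colour, so that all directions,
    oriented along the sequence, nearly agree.  A triangle on three of these
    points then has small angles at the first and at the last vertex. *)

Set Implicit Arguments.
Unset Strict Implicit.
Unset Printing Implicit Defensive.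

Import Order.TTheory GRing.Theory Num.Theory.

Lemma pairwise_index (T : eqType) (r : rel T) (s : seq T) (x y : T) :
  pairwise r s -> x \in s -> y \in s -> (index x s < index y s)%N -> r x y.
Proof.
move=> /(pairwiseP x) rs xs ys xy.
by have := rs _ _ _ _ xy; rewrite !nth_index // !inE !index_mem; apply.
Qed.

(** Separate targets [k c] per colour make the induction on their sum work. The head [x] splits the
    tail by colour, and a largest class, of colour [c], is searched with the target of [c] lowered
    by one. A sequence found there in colour [c] regains the missing element by prepending [x]; in
    any other colour it already suffices. *)
Lemma ramsey_pairwise (T : eqType) (C : finType) (f : T -> T -> C) (n : nat) :
  forall (k : C -> nat) (s : seq T), \sum_c k c = n -> (0 < #|C|)%N ->
    (#|C|.+1 ^ n <= size s)%N ->
  exists c t, [/\ subseq t s, size t = k c & pairwise (fun x y => f x y == c) t].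
Proof.
elim: n => [|n IHn] k s sumk C0 les.
  case/card_gt0P: (C0) => c _; exists c, [::]; split => //; first exact: sub0seq.
  by move/eqP: sumk; rewrite sum_nat_eq0 => /forallP/(_ c)/eqP ->.
case: s les => [|x s /= les]; first by rewrite leqn0 expn_eq0.
(* Pigeonhole: if every class had fewer than [#|C|.+1 ^ n] elements, [x :: s] would be shorter than
   [#|C|.+1 ^ n.+1]. *)
have [c lec] : exists c, (#|C|.+1 ^ n <= size [seq y <- s | f x y == c])%N.
  apply/existsP; apply: contraLR les; rewrite negb_exists => /forallP ltc.
  have szs : size s = \sum_c size [seq y <- s | f x y == c].
    under eq_bigr do rewrite size_filter -sum1_count big_mkcond.
    rewrite exchange_big /= -sum1_size; apply: eq_bigr => y _.
    by rewrite -big_mkcond (big_pred1 (f x y)).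
  have lts : (\sum_c size [seq y <- s | f x y == c] + #|C|
              <= #|C| * #|C|.+1 ^ n)%N.
    rewrite -[X in (_ + X)%N]sum1_card -big_split -sum_nat_const leq_sum // => c _.
    by have := ltc c; rewrite -ltnNge /= addn1.
  rewrite -ltnNge szs expnS mulSn.
  rewrite -addn2 addnC -(addn1 1) -addnA leq_add ?expn_gt0 //.
  by rewrite addnC (leq_trans _ lts) // leq_add2l.
have [kc0|kc_gt0] := posnP (k c).
  by exists c, [::]; split => //; exact: sub0seq.
(* Since [k c] is positive here, the truncated subtraction lowers the sum by exactly one. *)
pose k' b := (k b - (b == c))%N.
have sumk' : \sum_b k' b = n.
  have eqk : \sum_(b | b != c) k' b = \sum_(b | b != c) k b.
    by apply: eq_bigr => b /negPf bc; rewrite /k' bc subn0.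
  apply: succn_inj; rewrite -sumk (bigD1 c) //= [RHS](bigD1 c) //= eqk -addSn.
  by rewrite /k' eqxx subn1 prednK.
have [b [t [tsub szt monot]]] := IHn k' _ sumk' C0 lec.
move: tsub; rewrite subseq_filter => /andP[tc ts].
have [bc|bc] := eqVneq b c; last first.
  exists b, t; split => //; first exact: (subseq_trans ts (subseq_cons s x)).
  by rewrite szt /k' (negPf bc) subn0.
exists c, (x :: t); split => /=; first by rewrite eqxx.
  by rewrite szt /k' bc eqxx; lia.
by rewrite tc -bc.
Qed.

Local Open Scope ring_scope.

Section Directions.
Variables (R : realType) (d : nat).
Implicit Types u v w : 'rV[R]_d.

Definition dir u : 'rV[R]_d := (enorm u)^-1 *: u.

Lemma dotpNN u v : dotp (- u) (- v) = dotp u v.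
Proof. by apply: eq_bigr => i _; rewrite !mxE mulrNN. Qed.

Lemma dotp_dir u v : dotp (dir u) (dir v) = dotp u v / (enorm u * enorm v).
Proof.
rewrite /dotp mulr_suml; apply: eq_bigr => i _.
by rewrite !mxE invfM; ring.
Qed.

Lemma dotp_ge0 u : 0 <= dotp u u.
Proof. by apply: sumr_ge0 => i _; rewrite -expr2 sqr_ge0. Qed.

Lemma enorm_eq0 u : (enorm u == 0) = (u == 0).
Proof.
rewrite /enorm sqrtr_eq0 le_eqVlt ltNge dotp_ge0 orbF.
apply/eqP/eqP => [|->]; last by apply: big1 => i _; rewrite mxE mul0r.
move=> u0; apply/rowP => i; rewrite mxE; apply/eqP.
have /= := @psumr_eq0P R 'I_d predT (fun j => u ord0 j * u ord0 j).
move=> /(_ _ u0 i isT) uu; rewrite -sqrf_eq0 expr2 uu // => j _.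
by rewrite -expr2 sqr_ge0.
Qed.

Lemma dotp_dir_id u : u != 0 -> dotp (dir u) (dir u) = 1.
Proof.
move=> u0; rewrite dotp_dir -expr2 sqr_sqrtr ?dotp_ge0 // divff //.
by apply: contra_neq u0 => uu; apply/eqP; rewrite -enorm_eq0 /enorm uu sqrtr0.
Qed.

Lemma dir_bound u i : u != 0 -> -1 <= dir u ord0 i <= 1.
Proof.
move=> u0; rewrite -ler_norml -(ler_pXn2r (n := 2)) ?nnegrE //.
rewrite real_normK ?num_real // expr1n -(dotp_dir_id u0) /dotp (bigD1 i) //=.
by rewrite expr2 lerDl sumr_ge0 // => j _; rewrite -expr2 sqr_ge0.
Qed.

Lemma sum_sqr_dir u v : u != 0 -> v != 0 ->
  \sum_i (dir u ord0 i - dir v ord0 i) ^+ 2 = 2 - 2 * dotp (dir u) (dir v).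
Proof.
move=> u0 v0; transitivity (dotp (dir u) (dir u) + dotp (dir v) (dir v)
  - 2 * dotp (dir u) (dir v)); last by rewrite !dotp_dir_id.
rewrite /dotp mulr_sumr -big_split -sumrB; apply: eq_bigr => i _ /=; ring.
Qed.

(* Coordinates of a unit vector lie in [-1, 1], so the truncation is at most 2m
   and inord does not fall back on its default value. *)
Definition cell (m : nat) u : {ffun 'I_d -> 'I_(2 * m).+1} :=
  [ffun i => inord (Num.truncn (m%:R * (dir u ord0 i + 1)))].

(** Equal truncations put both scaled coordinates in one half-open unit interval, and the shift by 1
    cancels in the difference. *)
Lemma cell_close m u v i : u != 0 -> v != 0 -> cell m u = cell m v ->
  (m%:R * (dir u ord0 i - dir v ord0 i)) ^+ 2 <= 1.
Proof.
move=> u0 v0 /ffunP/(_ i); rewrite !ffunE => /(congr1 val) /=.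
have bnd w : w != 0 -> 0 <= m%:R * (dir w ord0 i + 1) <= (2 * m)%:R.
  move=> /(dir_bound i)/andP[lo hi]; rewrite natrM.
  by have := ler0n R m; nra.
have [u1 u2] := andP (bnd _ u0); have [v1 v2] := andP (bnd _ v0).
have lt w : 0 <= m%:R * (dir w ord0 i + 1) <= (2 * m)%:R ->
    (Num.truncn (m%:R * (dir w ord0 i + 1)) < (2 * m).+1)%N.
  move=> /andP[w1 w2]; rewrite ltnS -(ler_nat R) (le_trans _ w2) //.
  by have /andP[] := truncn_itv w1.
rewrite !inordK ?lt ?bnd // => eqt.
have := truncn_itv u1; have := truncn_itv v1; rewrite eqt -natr1.
move: (_%:R) => t /andP[? ?] /andP[? ?].
rewrite -[X in _ <= X](expr1n _ 2) -ler_sqrt ?expr1n // sqrtr1 sqrtr_sqr.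
rewrite ler_norml; lra.
Qed.

(** Summing [cell_close] over the [d] coordinates bounds the squared chord between the two unit
    vectors, which is 2 minus twice their cosine. *)
Lemma dotp_dir_cell m u v : u != 0 -> v != 0 -> cell m u = cell m v ->
  2 * m%:R ^+ 2 * (1 - dotp (dir u) (dir v)) <= d%:R.
Proof.
move=> u0 v0 uv.
have -> : 2 * m%:R ^+ 2 * (1 - dotp (dir u) (dir v)) =
    m%:R ^+ 2 * (2 - 2 * dotp (dir u) (dir v)) by ring.
rewrite -sum_sqr_dir // mulr_sumr.
rewrite -[d in _ <= d%:R]card_ord -sumr_const; apply: ler_sum => i _.
by rewrite -exprMn; exact: cell_close.
Qed.

Lemma acos_le (t e : R) : 0 <= e <= pi -> cos e <= t <= 1 -> acos t <= e.
Proof.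
move=> e0 /andP[et t1].
have t11 : -1 <= t <= 1 by rewrite t1 (le_trans (cos_geN1 e) et).
rewrite leNgt; apply/negP => lte; move: et; rewrite leNgt => /negP; apply.
rewrite -[X in X < _]acosK ?in_itv //=.
by rewrite ltr_cos // in_itv //= acos_ge0 // acos_lepi.
Qed.

Lemma angle_cell (eps : R) : 0 < eps ->
  exists m, forall a b c, a != b -> c != b ->
    cell m (a - b) = cell m (c - b) -> angle a b c <= eps.
Proof.
(* The cap at [pi] keeps [e] in the range where [cos] is decreasing. *)
move=> eps0; pose e := Num.min eps pi.
have e0 : 0 < e by rewrite lt_min eps0 pi_gt0.
have epi : e <= pi by rewrite ge_min lexx orbT.
have cose : cos e < 1.
  by rewrite -cos0 ltr_cos // in_itv /= ?lexx ?pi_ge0 ?(ltW e0).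
have de0 : 0 <= d%:R / (1 - cos e) by rewrite divr_ge0 // subr_ge0 ltW.
(* This gives [d < m * (1 - cos e)]. A cosine [t] below [cos e] would then yield [d < m * (1 - t) <=
   m ^ 2 * (1 - t) <= d / 2]. *)
pose m := (Num.truncn (d%:R / (1 - cos e))).+1; exists m => a b c ab cb abc.
have ab0 : a - b != 0 by rewrite subr_eq0.
have cb0 : c - b != 0 by rewrite subr_eq0.
rewrite /angle -dotp_dir; set t := dotp _ _.
have lem := dotp_dir_cell ab0 cb0 abc.
apply: (@le_trans _ _ e); last by rewrite ge_min lexx.
apply: acos_le; first by rewrite ltW.
(* Cauchy-Schwarz for unit vectors, read off from the nonnegative squared chord. *)
have t1 : t <= 1.
  have : 0 <= 2 - 2 * t.
    by rewrite /t -sum_sqr_dir // sumr_ge0 // => i _; rewrite sqr_ge0.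
  lra.
rewrite t1 andbT leNgt; apply/negP => te.
have dm : d%:R < m%:R * (1 - cos e).
  rewrite -ltr_pdivrMr ?subr_gt0 //.
  by have /andP[] := truncn_itv de0.
have m1 : 1 <= m%:R :> R by rewrite ler1n.
have dmt : d%:R < m%:R * (1 - t).
  by apply: (lt_le_trans dm); rewrite ler_wpM2l ?ler0n // lerD2l lerN2 ltW.
have : m%:R * (1 - t) <= m%:R * (m%:R * (1 - t)).
  by rewrite ler_peMl // (le_trans _ (ltW dmt)).
move: lem; rewrite -/t -mulrA expr2 -[_ * _ * (1 - t)]mulrA.
by have := ler0n R d; lra.
Qed.

(** Colours record directions pointing forward along the sequence, but at the last vertex of a
    triangle both sides point backward; the central symmetry reverses them. *)
Lemma angle_opp (a b c : 'rV[R]_d) : angle (- a) (- b) (- c) = angle a b c.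
Proof. by rewrite /angle /enorm -!opprD !dotpNN. Qed.

End Directions.

Lemma card_le_fset (T : choiceType) (S : set T) (N : nat) :
  (`I_N #<= S)%card ->
  exists F : {fset T}, ([set` F] `<=` S)%classic /\ (N <= #|` F|%fset)%N.
Proof.
move=> NS; have [finS|infS] := pselect (finite_set S).
  by exists (fset_set S); rewrite fset_setK //; split=> //; exact: leq_card_fset_set.
by have [F FS NF] := infinite_set_fset N infS; exists F.
Qed.

Theorem theorem9 (R : realType) (d k : nat) (eps : R)
    (hd : (1 <= d)%N) (hk : (0 < k)%N) (heps : (0 < eps)%R) :
  exists N : nat, (0 < N)%N /\
    forall S : set 'rV[R]_d, (`I_N #<= S)%card ->
      exists K : {fset 'rV[R]_d},
        [/\ ([set` K] `<=` S)%classic, #|` K|%fset = k & eps_collinear eps K].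
Proof.
have [m small] := angle_cell d heps.
pose C := {ffun 'I_d -> 'I_(2 * m).+1}.
(* The Ramsey bound with the same target [k] for every colour. *)
exists (#|C|.+1 ^ (\sum_(c : C) k))%N; split=> [|S]; first by rewrite expn_gt0.
move=> /card_le_fset[F [FS szF]].
have C0 : (0 < #|C|)%N by apply/card_gt0P; exists [ffun=> ord0].
have [c0 [t [ts szt mono]]] := ramsey_pairwise
  (fun x y => cell m (y - x) : C) (erefl _) C0 szF.
have ut := subseq_uniq ts (fset_uniq F).
exists [fset x in t]%fset; split.
- by move=> x /=; rewrite inE => /(mem_subseq ts)/FS.
- by rewrite card_fseq undup_id.
move=> a b c; rewrite !inE /= => a_t b_t c_t ab bc ca.
have idx x y : x \in t -> y \in t -> x != y -> index x t != index y t.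
  by move=> xt yt; apply: contra_neq => exy; rewrite -(nth_index x xt) exy nth_index.
have first_small x y z : x \in t -> y \in t -> z \in t -> y != x -> z != x ->
    (index x t < index y t)%N -> (index x t < index z t)%N ->
    angle y x z <= eps.
  move=> xt yt zt yx zx xy xz; apply: small => //.
  by rewrite (eqP (pairwise_index mono xt yt xy)) (eqP (pairwise_index mono xt zt xz)).
have last_small x y z : x \in t -> y \in t -> z \in t -> y != x -> z != x ->
    (index y t < index x t)%N -> (index z t < index x t)%N ->
    angle y x z <= eps.
  move=> xt yt zt yx zx xy xz; rewrite -angle_opp.
  apply: small; rewrite ?eqr_opp // !opprK ![- _ + x]addrC.
  by rewrite (eqP (pairwise_index mono yt xt xy)) (eqP (pairwise_index mono zt xt xz)).
have ba : b != a by rewrite eq_sym.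
have cb : c != b by rewrite eq_sym.
have ac : a != c by rewrite eq_sym.
have := idx a b a_t b_t ab; have := idx b c b_t c_t bc; have := idx c a c_t a_t ca.
(* Of the eight sign patterns, two are cyclic and impossible; the other six are the orders of [a],
   [b], [c] in [t], and the small angles sit at the first and last of the three. *)
case: ltngtP => // ica _; case: ltngtP => // ibc _; case: ltngtP => // iab _.
- by have := ltn_trans (ltn_trans iab ibc) ica; rewrite ltnn.
- by apply: Or31; split; [apply: last_small|apply: first_small].
- by apply: Or32; split; [apply: last_small|apply: first_small].
- by apply: Or33; split; [apply: first_small|apply: last_small].
- by apply: Or33; split; [apply: last_small|apply: first_small].
- by apply: Or32; split; [apply: first_small|apply: last_small].
- by apply: Or31; split; [apply: first_small|apply: last_small].
- by have := ltn_trans (ltn_trans ica ibc) iab; rewrite ltnn.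
Qed.
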